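(* Let $U=\{x_1,\dots,x_n\}$ be a finite set. Let $\mathbb{R}$ be the set of all equivalence relations on $U$, and let $$NS=\big\{\mathrm{Min}\big(\{\theta(\mathbf{v}):\mathbf{v}\in\mathcal{N}_{GF(2)}(A)\}\setminus\{\emptyset\}\big): A\in\mathcal{A}\big\},$$ where $\mathcal{A}$ is the set of binary dependence matrices over $GF(2)$ with $n$ columns labeled, in order, by $x_1,\dots,x_n$. Then $(\mathbb{R},\cap)\cong(NS,\cap)$ as closed algebraic systems; that is, there is a bijection $f:\mathbb{R}\to NS$ such that $f(R_1\cap R_2)=f(R_1)\cap f(R_2)$ for all $R_1,R_2\in\mathbb{R}$.
   Context: $GF(2)$ is the two-element field. An $m\times n$ matrix $A=[\alpha_1,\dots,\alpha_n]$ over a field $F$ is a binary dependence matrix if (1) $\alpha_i\neq\mathbf{0}$ for all $i$; and (2) for all $k\in\{2,\dots,n\}$ and all distinct indices $i_1,\dots,i_k$, if the rank over $F$ of $[\alpha_{i_1},\dots,\alpha_{i_k}]$ is $<k$, then there are two distinct indices $i_p,i_q$ among $i_1,\dots,i_k$ such that the rank over $F$ of $[\alpha_{i_p},\alpha_{i_q}]$ is $<2$. (The number $m$ of rows is arbitrary.) The null space is $\mathcal{N}_{F}(A)=\{\mathbf{x}\in F^n: A\mathbf{x}=\mathbf{0}\}$. The support of $\mathbf{v}=(v_1,\dots,v_n)^T\in F^n$ is $\theta(\mathbf{v})=\{x_i\in U: v_i\neq 0\}$. For a family $\mathcal{S}$ of subsets of $U$, $\mathrm{Min}(\mathcal{S})$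 is the family of inclusion-minimal members of $\mathcal{S}$. Equivalence relations are viewed as subsets of $U\times U$, and elements of $NS$ as sets of subsets of $U$; $\cap$ is set intersection in both cases. *)

(* Defs.v *)
From mathcomp Require Import all_boot all_order all_algebra.
From mathcomp Require Import classical_sets functions.

Set Implicit Arguments.
Unset Strict Implicit.
Unset Printing Implicit Defensive.

Import GRing.Theory.
Local Open Scope ring_scope.

Definition binary_dependence_matrix (F : fieldType) (m n : nat)
    (A : 'M[F]_(m, n)) : Prop :=
  (forall i : 'I_n, col i A <> 0) /\
  (forall (k : nat) (s : 'I_k -> 'I_n), (2 <= k <= n)%N -> injective s ->
     (\rank (colsub s A) < k)%N ->
     exists p q : 'I_k,
       p <> q /\ (\rank (row_mx (col (s p) A) (col (s q) A)) < 2)%N).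

Definition null_space (F : finFieldType) (m n : nat) (A : 'M[F]_(m, n)) :
    {set 'cV[F]_n} :=
  [set v | A *m v == 0].

(* The map x labels the coordinates by the elements of U. *)
Definition supp (U : finType) (F : finFieldType) (n : nat) (x : 'I_n -> U)
    (v : 'cV[F]_n) : {set U} :=
  [set x i | i : 'I_n & v i 0 != 0].

Definition Min (U : finType) (S : {set {set U}}) : {set {set U}} :=
  [set X | minset (mem S) X].

Definition min_supports (U : finType) (F : finFieldType) (m n : nat)
    (x : 'I_n -> U) (A : 'M[F]_(m, n)) : {set {set U}} :=
  Min ([set supp x v | v in null_space A] :\ finset.set0).

Definition equivalences (U : finType) : set {set U * U} :=
  [set R : {set U * U} |
     equivalence_rel (fun a b : U => (a, b) \in R)]%classic.

Definition NS (U : finType) (n : nat) (x : 'I_n -> U) : set {set {set U}} :=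
  [set S : {set {set U}} | exists (m : nat) (A : 'M['F_2]_(m, n)),
             binary_dependence_matrix A /\ S = min_supports x A]%classic.

Definition closed_system (T : Type) (A : set T) (op : T -> T -> T) : Prop :=
  forall a b : T, A a -> A b -> A (op a b).

Definition isomorphic_systems (T1 T2 : Type)
    (A1 : set T1) (op1 : T1 -> T1 -> T1)
    (A2 : set T2) (op2 : T2 -> T2 -> T2) : Prop :=
  [/\ closed_system A1 op1, closed_system A2 op2 &
      exists f : T1 -> T2, set_bij A1 A2 f /\
        (forall a b : T1, A1 a -> A1 b -> f (op1 a b) = op2 (f a) (f b))].

(* Main.v *)
(** The relation attached to a binary dependence matrix over GF(2) is "the
    columns labelled by a and b are equal".  Since nonzero vectors over GF(2)
    are proportional only when they are equal, any nonzero null vector has two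
    equal columns in its support, while two equal columns sum to zero; so the
    minimal supports are exactly the pairs {a, b} of distinct related elements.
    Conversely an equivalence relation R comes from its own 0/1 incidence
    matrix, in which pairwise inequivalent columns contain an identity
    submatrix and are thus independent.  Hence R |-> {{a, b} : a R b, a <> b}
    is the isomorphism. *)
Require Import Defs.
From mathcomp Require Import all_boot all_order all_algebra.
From mathcomp Require Import classical_sets functions.

(** Transposition turns dependent columns into dependent rows, for which the kernel supplies the
    witness. *)
Lemma rank_lt_colsP (F : fieldType) (m n : nat) (A : 'M[F]_(m, n)) :
  reflect (exists2 w : 'cV[F]_n, w != 0%R & (A *m w = 0)%R) (\rank A < n)%N.
Proof.
rewrite -mxrank_tr ltn_neqAle rank_leq_row andbT -[_ != _]/(~~ row_free _).
rewrite -kermx_eq0; apply: (iffP rowV0Pn) => -[w].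
  move=> /sub_kermxP wA w0; exists (w^T)%R; first by rewrite trmx_eq0.
  by apply: trmx_inj; rewrite trmx_mul trmxK trmx0.
move=> w0 Aw; exists (w^T)%R; last by rewrite trmx_eq0.
by apply/sub_kermxP; rewrite -trmx_mul Aw trmx0.
Qed.

Lemma F2_neq0 (a : 'F_2) : a != 0%R -> a = 1%R.
Proof. by case: a => [[|[|]]] //= *; apply: val_inj. Qed.

Lemma mulmx_sum_colE (F : fieldType) (m n : nat) (A : 'M[F]_(m, n))
    (v : 'cV[F]_n) : (A *m v = \sum_j v j 0 *: col j A)%R.
Proof.
apply/colP => i; rewrite mxE summxE; apply: eq_bigr => j _.
by rewrite !mxE GRing.mulrC.
Qed.

Lemma F2_addrr (m : nat) (u : 'cV['F_2]_m) : (u + u = 0)%R.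
Proof.
apply/colP => i; rewrite !mxE.
by case: (u i _) => [[|[|]]] //= ?; apply: val_inj.
Qed.

Lemma F2_rank_pair (m : nat) (u v : 'cV['F_2]_m) :
  u <> 0%R -> v <> 0%R -> (\rank (row_mx u v) < 2)%N = (u == v).
Proof.
(* Writing the column count as [1 + 1] lets the witness [w] split into its two scalar
   coefficients. *)
move=> u0 v0; apply/(@rank_lt_colsP _ _ (1 + 1))/eqP => [[w]|<-]; last first.
  exists (col_mx 1%:M 1%:M)%R; last by rewrite mul_row_col !mulmx1 F2_addrr.
  by rewrite col_mx_eq0 negb_and -mxrank_eq0 mxrank1.
rewrite -[w]vsubmxK mul_row_col [usubmx w]mx11_scalar [dsubmx w]mx11_scalar.
rewrite !mul_mx_scalar col_mx_eq0 negb_and.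
have [->|/F2_neq0->] := eqVneq (usubmx w 0 0)%R 0%R;
    have [->|/F2_neq0->] := eqVneq (dsubmx w 0 0)%R 0%R.
- by rewrite !GRing.raddf0 eqxx.
- by rewrite GRing.scale0r GRing.add0r GRing.scale1r => _ /v0.
- by rewrite GRing.scale0r GRing.addr0 GRing.scale1r => _ /u0.
rewrite !GRing.scale1r => _ /(congr1 (fun z => z + v)%R).
by rewrite -GRing.addrA F2_addrr GRing.addr0 GRing.add0r.
Qed.

(** The columns indexed by the support [D] of [v] sum to zero. No column is zero, so [D] has at
    least two elements, and the dependence condition for the enumeration [s] of [D] yields two
    columns of joint rank below 2, hence equal. *)
Lemma dependence_equal_columns (m n : nat) (A : 'M['F_2]_(m, n)) v :
  binary_dependence_matrix A -> v \in null_space A -> v != 0%R ->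
  exists i j, [/\ i != j, (v i 0 != 0)%R, (v j 0 != 0)%R & col i A = col j A].
Proof.
move=> [colA depA]; rewrite inE => /eqP Av v0.
pose D := [set i | v i 0 != 0]%R; pose s := @enum_val _ (mem D).
have sD p : (v (s p) 0 != 0)%R by have := enum_valP p; rewrite inE.
have sumD : (\sum_p v (s p) 0 *: col (s p) A = 0)%R.
  rewrite -[RHS]Av mulmx_sum_colE (bigID (mem D)) /= [X in (_ + X)%R]big1.
    by rewrite GRing.addr0 [RHS]big_enum_val.
  by move=> i; rewrite inE negbK => /eqP ->; rewrite GRing.scale0r.
have Dgt0 : (0 < #|D|)%N.
  rewrite lt0n; apply: contraNneq v0 => /eqP; rewrite cards_eq0 => /eqP D0.
  apply/eqP/colP => i; rewrite mxE; apply/eqP; have := finset.in_set0 i.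
  by rewrite -D0 inE => /negbFE.
have Dgt1 : (1 < #|D|)%N.
  rewrite ltn_neqAle Dgt0 andbT; apply/negP => /eqP D1.
  move: sumD; rewrite (bigD1 (Ordinal Dgt0)) //= big1 ?GRing.addr0 => [|p].
    rewrite (F2_neq0 _ (sD _)) GRing.scale1r; exact: colA.
  rewrite -val_eqE /= -lt0n; have := ltn_ord p.
  by rewrite -[X in (_ < X)%N]D1 ltnS leqn0 => /eqP ->.
have [||p [q [/eqP pq]]] := depA _ s _ enum_val_inj.
- by rewrite Dgt1 /= (leq_trans (max_card _)) ?card_ord.
- apply/rank_lt_colsP; exists (\col_p v (s p) 0)%R.
    by apply/eqP => /colP/(_ (Ordinal Dgt0))/eqP; rewrite !mxE (negPf (sD _)).
  rewrite mulmx_sum_colE -[RHS]sumD; apply: eq_bigr => p _.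
  by rewrite mxE; congr (_ *: _)%R; apply/colP => i; rewrite !mxE.
rewrite F2_rank_pair // => /eqP eqpq.
by exists (s p), (s q); split=> //; rewrite (inj_eq enum_val_inj).
Qed.

(** The diagonal is left out because {a, a} is a singleton; reflexivity makes it recoverable. *)
Definition related_pairs {U : finType} (R : {set U * U}) : {set {set U}} :=
  [set [set p.1; p.2] | p in R & p.1 != p.2].

Lemma related_pairsP {U : finType} (R : {set U * U}) (X : {set U}) :
  reflect (exists a b, [/\ a != b, (a, b) \in R & X = [set a; b]])
          (X \in related_pairs R).
Proof.
apply: (iffP imsetP) => [[[a b]]|[a [b [ab Rab ->]]]].
  by rewrite inE => /andP[Rab ab] ->; exists a, b.
by exists (a, b) => //; rewrite inE Rab.
Qed.

Lemma equivalences_refl {U : finType} (R : {set U * U}) a :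
  equivalences R -> (a, a) \in R.
Proof. by move=> eqR; have [] := eqR a a a. Qed.

(** [equivalence_rel] merges symmetry and transitivity: R a b forces R a c = R b c. Symmetry is the
    case c = a. *)
Lemma equivalences_sym {U : finType} (R : {set U * U}) a b :
  equivalences R -> ((a, b) \in R) = ((b, a) \in R).
Proof.
have sym c d : equivalences R -> (c, d) \in R -> (d, c) \in R.
  by move=> eqR Rcd; have [_ /(_ Rcd) <-] := eqR c d c; apply: equivalences_refl.
by move=> eqR; apply/idP/idP; apply: sym.
Qed.

(** An unordered pair fixes its elements up to order, and the symmetry of [R] absorbs the swap. *)
Lemma mem_related_pairs {U : finType} (R : {set U * U}) a b :
  equivalences R ->
  ([set a; b] \in related_pairs R) = (a != b) && ((a, b) \in R).
Proof.
move=> eqR; apply/related_pairsP/andP => [|[ab Rab]]; last by exists a, b.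
move=> [c [d [cd Rcd /setP abcd]]].
have Rdc : (d, c) \in R by rewrite equivalences_sym.
have dc : d != c by rewrite eq_sym.
move: (abcd a) (abcd b) (abcd c) (abcd d); rewrite !inE !eqxx ?orbT /=.
move=> /esym/orP[]/eqP-> /esym/orP[]/eqP->;
  by rewrite ?eqxx ?orbb ?orbT ?(negPf cd) ?(negPf dc).
Qed.

Section MinimalSupports.
Context {U : finType} {n : nat} (x : 'I_n -> U) (y : U -> 'I_n).
Context (xK : cancel x y) (yK : cancel y x).

Definition equal_columns {m : nat} (A : 'M['F_2]_(m, n)) : {set U * U} :=
  [set p | col (y p.1) A == col (y p.2) A].

Lemma equivalences_equal_columns m (A : 'M['F_2]_(m, n)) :
  equivalences (equal_columns A).
Proof.
by move=> a b c; rewrite !inE /= eqxx; split=> // /eqP ->.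
Qed.

Lemma supp_eq0 (v : 'cV['F_2]_n) : (supp x v == finset.set0) = (v == 0%R).
Proof.
apply/eqP/eqP => [sv|->]; last first.
  by apply/setP => a; rewrite inE; apply/imsetP => -[i]; rewrite !inE mxE eqxx.
apply/colP => i; rewrite mxE; apply/eqP; apply: contraT => vi.
have : x i \in supp x v by apply: imset_f; rewrite inE.
by rewrite sv inE.
Qed.

(** The labels of two equal columns form a support, and every nonempty support contains such a pair;
    having two elements each, no pair lies properly in another. *)
Lemma min_supportsE m (A : 'M['F_2]_(m, n)) :
  binary_dependence_matrix A ->
  min_supports x A = related_pairs (equal_columns A).
Proof.
move=> bdA; set S := [set supp x v | v in null_space A] :\ finset.set0.
have pairS X : X \in related_pairs (equal_columns A) -> X \in S.
  move=> /related_pairsP[a [b [ab]]]; rewrite inE /= => /eqP colab ->.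
  have yab : y a != y b by rewrite (inj_eq (can_inj yK)).
  rewrite !inE; apply/andP; split.
    by apply/eqP => /setP/(_ a); rewrite !inE eqxx.
  apply/imsetP; exists (delta_mx (y a) 0 + delta_mx (y b) 0)%R.
    by rewrite inE mulmxDr -!colE colab F2_addrr.
  apply/setP => c; rewrite -(yK c) /supp mem_imset; last exact: can_inj xK.
  rewrite !inE !mxE yK !andbT -!(inj_eq (can_inj yK)).
  (* The two unit vectors sit at distinct coordinates, so no cancellation 1 + 1 = 0 occurs. *)
  have [->|_] := eqVneq (y c) (y a); last by case: (y c == y b).
  by rewrite (negPf yab).
have Spair X : X \in S ->
    exists2 Y, Y \in related_pairs (equal_columns A) & Y \subset X.
  rewrite !inE => /andP[X0 /imsetP[v Nv Xv]].
  have v0 : v != 0%R by rewrite -supp_eq0 -Xv.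
  have [i [j [ij vi vj colij]]] := dependence_equal_columns _ _ _ _ bdA Nv v0.
  exists [set x i; x j].
    apply/related_pairsP; exists (x i), (x j).
    by rewrite (inj_eq (can_inj xK)) inE /= !xK colij.
  by rewrite Xv; apply/fintype.subsetP => a /set2P[]->; apply: imset_f; rewrite inE.
apply/setP => X; rewrite inE; apply/minsetP/idP => [[/Spair[Y YR YX] minX]|XR].
  by rewrite -(minX Y) //; apply: pairS.
split=> [|Z /Spair[Y YR YZ] ZX]; first exact: pairS.
(* A support [Z] inside the pair [X] contains a pair [Y], so comparing cardinals gives [Z = X]. *)
apply/eqP; rewrite eqEcard ZX (leq_trans _ (subset_leq_card YZ)) //.
move: XR YR => /related_pairsP[a [b [ab _ ->]]] /related_pairsP[c [d [cd _ ->]]].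
by rewrite !cards2 ab cd.
Qed.

(** Column j is the indicator of the class of [x j]. Indexing rows by elements rather than classes
    avoids choosing representatives. *)
Definition relation_mx (R : {set U * U}) : 'M['F_2]_n :=
  (\matrix_(i, j) ((x i, x j) \in R)%:R)%R.

Lemma equal_columns_relation_mx (R : {set U * U}) :
  equivalences R -> equal_columns (relation_mx R) = R.
Proof.
move=> eqR; apply/setP => -[a b]; rewrite inE /=.
(* In row [y a], column [y a] holds 1 by reflexivity, so equal columns put [(a, b)] in [R]. *)
apply/eqP/idP => [/colP/(_ (y a))|Rab].
  rewrite !mxE !yK equivalences_refl //.
  by case: ((a, b) \in R).
apply/colP => i; rewrite !mxE !yK ![(x i, _) \in R]equivalences_sym //.
by have [_ /(_ Rab) ->] := eqR a b (x i).
Qed.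

Lemma relation_mx_dependence (R : {set U * U}) :
  equivalences R -> binary_dependence_matrix (relation_mx R).
Proof.
move=> eqR.
have Rrefl a : (a, a) \in R by apply: equivalences_refl.
have col0 i : col i (relation_mx R) <> 0%R.
  by move=> /colP/(_ i); rewrite !mxE Rrefl.
split=> // k s _ s_inj rk.
have [/existsP[p /existsP[q /andP[pq Rpq]]]|indep] :=
    boolP [exists p, exists q, (p != q) && ((x (s p), x (s q)) \in R)].
  exists p, q; split; first exact/eqP.
  rewrite F2_rank_pair //.
  by rewrite -(equal_columns_relation_mx R eqR) inE /= !xK in Rpq.
(* Taking the rows along the same [s] gives ones on the diagonal by reflexivity and zeros elsewhere
   by [indep]. *)
have sub1 : rowsub s (colsub s (relation_mx R)) = (1%:M)%R.
  apply/matrixP => p q; rewrite !mxE; have [->|pq] := eqVneq p q.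
    by rewrite Rrefl.
  move: indep; rewrite negb_exists => /forallP/(_ p).
  by rewrite negb_exists => /forallP/(_ q); rewrite pq /= => /negPf ->.
have := mxrankS (rowsub_sub s (colsub s (relation_mx R))).
by rewrite sub1 mxrank1 leqNgt rk.
Qed.

End MinimalSupports.

Theorem theorem4 (U : finType) (n : nat) (x : 'I_n -> U)
    (x_bij : bijective x) :
  isomorphic_systems (@equivalences U) (fun R1 R2 => R1 :&: R2)
                     (NS x) (fun S1 S2 => S1 :&: S2).
Proof.
case: x_bij => y xK yK.
have closedR : closed_system (@equivalences U) (fun R1 R2 => R1 :&: R2).
  move=> R1 R2 eq1 eq2 a b c; have [r1 t1] := eq1 a b c.
  have [r2 t2] := eq2 a b c; rewrite !inE /= r1 r2.
  by split=> // /andP[/t1 -> /t2 ->].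
have pairsI (R1 R2 : {set U * U}) : equivalences R1 -> equivalences R2 ->
    related_pairs (R1 :&: R2) = related_pairs R1 :&: related_pairs R2.
  move=> eq1 eq2; apply/setP => X; rewrite inE.
  apply/related_pairsP/andP => [[a [b [ab]]]|].
    by rewrite inE => /andP[R1ab R2ab] ->; rewrite !mem_related_pairs ?ab.
  case=> /related_pairsP[a [b [ab R1ab ->]]].
  by rewrite mem_related_pairs // ab => R2ab; exists a, b; rewrite inE R1ab.
have pairsNS R : equivalences R -> NS x (related_pairs R).
  move=> eqR; exists n, (relation_mx x R).
  have bdR := relation_mx_dependence x y xK yK R eqR.
  split=> //.
  by rewrite (min_supportsE x y xK yK) // equal_columns_relation_mx.
have NSpairs S : NS x S -> exists2 R, equivalences R & related_pairs R = S.
  case=> m [A [bdA ->]]; exists (equal_columns y A).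
    exact: equivalences_equal_columns.
  by rewrite (min_supportsE x y xK yK).
split=> //.
  (* Closure of [NS x] is transported from that of the equivalence relations. *)
  move=> S1 S2 /NSpairs[R1 eq1 <-] /NSpairs[R2 eq2 <-].
  by rewrite -pairsI //; apply/pairsNS/closedR.
exists related_pairs; split=> //; split=> [||S /NSpairs[R]].
- exact: pairsNS.
- move=> R1 R2 /set_mem eq1 /set_mem eq2 eqP12; apply/setP => -[a b].
  (* The diagonal lies in both relations; off it, each relation is read off its pairs. *)
  have [<-|ab] := eqVneq a b.
    by rewrite !equivalences_refl.
  move: (mem_related_pairs _ a b eq1) (mem_related_pairs _ a b eq2).
  by rewrite ab eqP12 => ->.
- by exists R.
Qed.
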